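(* Let $T$ be a finite rooted tree with node set $\mathcal V$, cost function $c:\mathcal V\to\mathbb R_{\ge0}$, integer budget $B\ge1$, and importance function $r:\mathcal V\to\mathbb R_{>0}$. Let $\mathbf v$ be a hypernode with $S(\mathbf v)\neq\emptyset$ such that $\mathrm{Cost}(T_{\mathbf w})>0$ for every $\mathbf w\in H(\mathbf v)$. Then \[\mathrm{CV}^2\big(|\mathbf v|C_{\mathrm{SEI}}(T_{\mathbf v})\big)+1\le\sum_{\mathbf w\in H(\mathbf v)}\frac{1}{\binom{|S(\mathbf v)|-1}{|\mathbf w|-1}}\frac{r(S(\mathbf v))}{r(\mathbf w)}\left(\frac{\mathrm{Cost}(T_{\mathbf w})}{\mathrm{Cost}(T_{S(\mathbf v)})}\right)^2\Big(\mathrm{CV}^2\big(|\mathbf w|C_{\mathrm{SEI}}(T_{\mathbf w})\big)+1\Big),\] where $C_{\mathrm{SEI}}(T_{\mathbf u})$ denotes the output of the SEI algorithm started at the hypernode $\mathbf u$.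
   Context: For a node $v$, $S(v)$ is its set of children and $T_v$ is the subtree rooted at $v$, with $\mathrm{Cost}(T_v)=\sum_{u\in T_v}c(u)$. A hypernode is a set of distinct nodes of $T$ all at the same depth. For a set of nodes $\mathbf v$: $c(\mathbf v)=\sum_{v\in\mathbf v}c(v)$, $r(\mathbf v)=\sum_{v\in\mathbf v}r(v)$, $S(\mathbf v)=\bigcup_{v\in\mathbf v}S(v)$, $T_{\mathbf v}=\bigcup_{v\in\mathbf v}T_v$, and $\mathrm{Cost}(T_{\mathbf v})=\sum_{v\in\mathbf v}\mathrm{Cost}(T_v)$. The hyperchildren of $\mathbf v$ are $H(\mathbf v)=\{\mathbf w\subseteq S(\mathbf v): |\mathbf w|=\min(B,|S(\mathbf v)|)\}$. For a random variable $X$ with $\mathbb E[X]>0$, $\mathrm{CV}^2(X)=\mathrm{Var}(X)/\mathbb E[X]^2$. SEI algorithm started at $\mathbf v$: set $k=0$, $\mathbf x_0=\mathbf v$, $D=1$, $C=c(\mathbf x_0)/|\mathbf x_0|$. Repeat: if $S(\mathbf x_k)=\emptyset$, stop and output $C_{\mathrm{SEI}}(T_{\mathbf v})=C$. Otherwise choose $\mathbf x_{k+1}\in H(\mathbf x_k)$ by first choosing $x\in S(\mathbf x_k)$ with probability $r(x)/r(S(\mathbf x_k))$ and then choosing the remaining $\min(B,|S(\mathbf x_k)|)-1$ elements of $\mathbf x_{k+1}$ as a uniformly random subset of $S(\mathbf x_k)\setminus\{x\}$ (fresh randomness at each step); set $D_k=\frac{|\mathbf x_{k+1}|}{|\mathbf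 x_k|}\cdot\frac{r(S(\mathbf x_k))}{r(\mathbf x_{k+1})}$, $D\leftarrow D\cdot D_k$, $C\leftarrow C+\frac{c(\mathbf x_{k+1})}{|\mathbf x_{k+1}|}D$, $k\leftarrow k+1$. The estimator $|\mathbf u|C_{\mathrm{SEI}}(T_{\mathbf u})$ has mean $\mathrm{Cost}(T_{\mathbf u})$. *)

(* Defs.v *)
From HB Require Import structures.
(* in this order, so that set0, subset, ... denote those of finite sets *)
From mathcomp Require Import all_classical all_reals all_analysis.
From mathcomp Require Import all_boot all_order all_algebra.
Set Implicit Arguments.
Unset Strict Implicit.
Unset Printing Implicit Defensive.
Import Order.TTheory GRing.Theory Num.Theory.
Local Open Scope ring_scope.

(* A rooted tree on the finite node set V, given by its parent map; climbing
   from any node reaches the root, which excludes cycles and makes the root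
   the only node without a parent. *)
Record rootedTree (V : finType) := RootedTree {
  tree_root : V;
  parent : V -> option V;
  parent_root : parent tree_root = None;
  climb_root : forall u, exists k, iter k (obind parent) (Some u) == Some tree_root
}.

Section Tree.
Variables (V : finType) (T : rootedTree V).
Implicit Types (u : V) (A : {set V}).

Definition edge : rel V := fun u w => parent T w == Some u.

Definition children u : {set V} := [set w | edge u w].

Definition subtree u : {set V} := [set w | connect edge u w].

Definition depth u : nat := ex_minn (climb_root T u).

Definition hypernode A : Prop := {in A &, forall u w, depth u = depth w}.

Definition hchildren A : {set V} := \bigcup_(u in A) children u.

Definition hyperchildren (B : nat) A : {set {set V}} :=
  [set W : {set V} | (W \subset hchildren A) && (#|W| == minn B #|hchildren A|)].

Lemma edge_depth u w : edge u w -> depth w = (depth u).+1.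
Proof.
move=> /eqP uw; rewrite /depth.
case: ex_minnP => k /eqP kw kmin; case: ex_minnP => m /eqP mu mmin.
case: k kw kmin => [[wr]|k kw kmin].
  by move: uw; rewrite wr parent_root.
have e n : iter n.+1 (obind (parent T)) (Some w)
         = iter n (obind (parent T)) (Some u) by rewrite iterSr /= uw.
congr S; apply/eqP; rewrite eqn_leq mmin -?e ?kw ?eqxx// andbT.
by rewrite -ltnS kmin // e mu.
Qed.

Lemma subtree_child u w : edge u w -> (#|subtree w| < #|subtree u|)%N.
Proof.
move=> uw; apply: proper_card; apply/properP; split.
  by apply/subsetP => z; rewrite !inE; apply: connect_trans; exact: connect1.
exists u; rewrite !inE ?connect0//.
apply/negP => /connectP[p pP ulast].
have : (depth w <= depth (last w p))%N.
  elim: p w pP {ulast uw} => //= z p IH w /andP[wz /IH]; apply: leq_trans.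
  by rewrite (edge_depth wz).
by rewrite -ulast (edge_depth uw) ltnn.
Qed.

End Tree.

(* Finitely supported distributions, as lists of (probability, value) pairs; a
   value may occur several times, its probabilities then add up. *)
Section Dist.
Variable R : realType.

Definition dist (A : Type) := seq (R * A).

Definition dret (A : Type) (a : A) : dist A := [:: (1, a)].

Definition dbind (A A' : Type) (d : dist A) (f : A -> dist A') : dist A' :=
  [seq (o.1 * o'.1, o'.2) | o <- d, o' <- f o.2].

Definition dchoose (I : finType) (A : {set I}) (w : I -> R) : dist I :=
  [seq (w i / \sum_(j in A) w j, i) | i <- enum A].

Definition duniform (I : finType) (A : {set I}) : dist I :=
  dchoose A (fun=> 1).

Definition is_dist (A : Type) (d : dist A) : Prop :=
  all (fun o => 0 <= o.1) d /\ \sum_(o <- d) o.1 = 1.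

Lemma is_dist_ret (A : Type) (a : A) : is_dist (dret a).
Proof. by split; rewrite /= ?big_seq1// ler01. Qed.

Lemma is_dist_bind (A A' : Type) (d : dist A) (f : A -> dist A') :
  is_dist d -> (forall a, is_dist (f a)) -> is_dist (dbind d f).
Proof.
move=> [d0 d1] fP; split.
  elim: d d0 {d1} => //= o d IH /andP[ge0 /IH]; rewrite /dbind /= all_cat => ->.
  rewrite andbT all_map; case: (fP o.2) => + _.
  by apply: sub_all => o' /= o'0; rewrite mulr_ge0.
rewrite /dbind big_allpairs_dep /= -[RHS]d1; apply: eq_bigr => o _.
by rewrite -big_distrr /= (fP o.2).2 mulr1.
Qed.

Lemma is_dist_choose (I : finType) (A : {set I}) (w : I -> R) :
  A != set0 -> (forall i, 0 < w i) -> is_dist (dchoose A w).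
Proof.
move=> /set0Pn[i0 i0A] w0.
have s0 : 0 < \sum_(j in A) w j.
  by rewrite (bigD1 i0)//= ltr_wpDr// sumr_ge0// => i _; exact: ltW.
split.
  by rewrite all_map; apply/allP => i _ /=; rewrite divr_ge0 ?ltW.
by rewrite big_map big_enum /= -big_distrl /= divff// gt_eqF.
Qed.

End Dist.

Section SEI.
Variables (R : realType) (V : finType) (T : rootedTree V).
Variables (c : V -> {nonneg R}) (r : V -> {posnum R}) (B : nat).
Implicit Types (x w : {set V}) (C D : R).

Definition cost (A : {set V}) : R := \sum_(u in A) (c u)%:num.

Definition importance (A : {set V}) : R := \sum_(u in A) (r u)%:num.

(* Cost(T_A): the sum over u in A of Cost(T_u). *)
Definition Cost (A : {set V}) : R := \sum_(u in A) cost (subtree T u).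

Definition SEI_step x : dist R {set V} :=
  let Sx := hchildren T x in
  dbind (dchoose Sx (fun y => (r y)%:num)) (fun y =>
  dbind (duniform R [set Z : {set V} |
           (Z \subset Sx :\ y) && (#|Z| == (minn B #|Sx|).-1)]) (fun Z =>
  dret R (y |: Z))).

(* [fuel] bounds the number of iterations; by [SEI_runE] below the bound #|V|
   is never what stops the loop. *)
Fixpoint SEI_loop (fuel : nat) x D C : dist R R :=
  if fuel is n.+1 then
    let Sx := hchildren T x in
    if Sx == set0 then dret R C
    else dbind (SEI_step x) (fun w =>
      let Dk := #|w|%:R / #|x|%:R * (importance Sx / importance w) in
      let D' := D * Dk in
      SEI_loop n w D' (C + cost w / #|w|%:R * D'))
  else dret R C.

Definition SEI_run x D C : dist R R := SEI_loop #|V| x D C.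

Definition SEI_output (v : {set V}) : dist R R :=
  SEI_run v 1 (cost v / #|v|%:R).

Lemma SEI_runE x D C :
  SEI_run x D C =
    if hchildren T x == set0 then dret R C
    else dbind (SEI_step x) (fun w =>
      let D' := D * (#|w|%:R / #|x|%:R
                     * (importance (hchildren T x) / importance w)) in
      SEI_run w D' (C + cost w / #|w|%:R * D')).
Proof.
suff fuelS n (y : {set V}) E C' : (forall u, u \in y -> (#|subtree T u| <= n.+1)%N) ->
    SEI_loop n y E C' = SEI_loop n.+1 y E C'.
  by rewrite /SEI_run fuelS// => u _; apply: leqW; exact: max_card.
have eq_bind (A A' : eqType) (d : dist R A) (f g : A -> dist R A') :
    (forall o, o \in d -> f o.2 = g o.2) -> dbind d f = dbind d g.
  elim: d => //= o d IH fg; rewrite /dbind /= fg ?mem_head//; congr cat.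
  by apply: IH => o' o'd; rewrite fg// in_cons o'd orbT.
elim: n y E C' => [|n IH] y E C' hy.
  suff /eqP yS : hchildren T y == set0 by rewrite /= yS eqxx.
  apply/set0Pn => -[z /bigcupP[u /hy u1]]; rewrite inE => /subtree_child zu.
  have := leq_trans zu u1; rewrite ltnS leqn0 cards_eq0 => /eqP/setP/(_ z).
  by rewrite !inE connect0.
rewrite [RHS]/= [LHS]/=; case: ifP => // yS; apply: eq_bind => -[p w] wP /=.
apply: IH => u uw.
have {uw} : u \in hchildren T y.
  move/allpairsPdep: wP => [a [a1 [/mapP[z + ->] /allpairsPdep[a2 [a3]]]]].
  move=> + [/mapP[Z + ->]]; rewrite !mem_enum inE => zS /andP[/subsetP ZS _].
  rewrite mem_seq1 => /eqP -> -> [_ wE]; move: uw; rewrite wE /= !inE.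
  by case/predU1P => [->//|/ZS]; rewrite !inE => /andP[].
move=> /bigcupP[z /hy zy]; rewrite inE => /subtree_child zu.
by rewrite -ltnS (leq_trans zu).
Qed.

Lemma SEI_step_dist x : hchildren T x != set0 -> is_dist (SEI_step x).
Proof.
move=> S0; apply: is_dist_bind => [|y]; first exact: is_dist_choose.
apply: is_dist_bind => [|Z]; last exact: is_dist_ret.
apply: is_dist_choose => //; rewrite -card_gt0 cards_draws bin_gt0.
rewrite (@leq_trans #|hchildren T x|.-1)//.
  by rewrite -!subn1 leq_sub2r// geq_minr.
by rewrite (cardsD1 y); case: (y \in _) => //=; rewrite add0n leq_pred.
Qed.

Lemma SEI_run_dist x D C : is_dist (SEI_run x D C).
Proof.
rewrite /SEI_run; elim: #|V| x D C => [|n IH] x D C /=; first exact: is_dist_ret.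
case: ifPn => [_|S0]; first exact: is_dist_ret.
by apply: is_dist_bind; [exact: SEI_step_dist|move=> w; exact: IH].
Qed.

(* The law of C_SEI(T_v), as a probability measure on the reals. *)
Definition SEI_law (v : {set V}) (A : set (measurableTypeR R)) : \bar R :=
  (\sum_(o <- SEI_output v) o.1%:E * \d_(o.2 : measurableTypeR R) A)%E.

Lemma SEI_law_msum v : exists (w : nat -> {nonneg R}) (a : nat -> measurableTypeR R) n,
  SEI_law v = msum (fun i => mscale (w i) \d_(a i)) n.
Proof.
have [ge0 _] := SEI_run_dist v 1 (cost v / #|v|%:R).
set d := SEI_output v.
have w0 i : 0 <= (nth (0, 0) d i).1.
  by have [ilt|ige] := ltnP i (size d); [exact: (all_nthP _ ge0)|rewrite nth_default].
exists (fun i => NngNum (w0 i)), (fun i => (nth (0, 0) d i).2), (size d).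
apply: boolp.funext => A; rewrite /SEI_law -/d /msum (big_nth (0, 0)) big_mkord.
by apply: eq_bigr.
Qed.

Section Law.
Variable v : {set V}.

Let SEI_law0 : SEI_law v classical_sets.set0 = 0%E.
Proof. by have [w [a [n ->]]] := SEI_law_msum v; rewrite measure0. Qed.

Let SEI_law_ge0 A : (0 <= SEI_law v A)%E.
Proof. by have [w [a [n ->]]] := SEI_law_msum v. Qed.

Let SEI_law_additive : semi_sigma_additive (SEI_law v).
Proof.
have [w [a [n ->]]] := SEI_law_msum v; exact: measure_semi_sigma_additive.
Qed.

HB.instance Definition _ := isMeasure.Build _ _ _ (SEI_law v)
  SEI_law0 SEI_law_ge0 SEI_law_additive.

Let SEI_law_setT : SEI_law v classical_sets.setT = 1%E.
Proof.
rewrite /SEI_law -[1%E]/((1 : R)%:E) -(SEI_run_dist v 1 (cost v / #|v|%:R)).2.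
by rewrite -sumEFin; apply: eq_bigr => o _; rewrite diracT mule1.
Qed.

HB.instance Definition _ :=
  Measure_isProbability.Build _ _ _ (SEI_law v) SEI_law_setT.

End Law.

End SEI.

Definition CV2 d (Omega : measurableType d) (R : realType)
    (P : probability Omega R) (X : Omega -> R) : R :=
  fine 'V_P[X]%E / (fine 'E_P[X]%E) ^+ 2.

(* CV^2(|v| C_SEI(T_v)). *)
Definition CV2_SEI (R : realType) (V : finType) (T : rootedTree V)
    (c : V -> {nonneg R}) (r : V -> {posnum R}) (B : nat) (v : {set V}) : R :=
  CV2 (SEI_law T c r B v) (fun C => #|v|%:R * C).

(* Main.v *)
Require Import Defs.
From mathcomp Require Import all_classical all_reals all_analysis.
From mathcomp Require Import measurable_realfun.
From mathcomp Require Import all_boot all_order all_algebra.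
From mathcomp Require Import ring lra.

(* Write Z_v = |v| C_SEI(T_v).  A hyperchild w is chosen with probability
   P(w) = r(w) / (r(S(v)) binom(|S(v)|-1, |w|-1)), and then
   Z_v = c(v) + (r(S(v)) / r(w)) Z_w.  Hence
     A := E[(Z_v - c(v))^2] = sum_w P(w) (r(S(v)) / r(w))^2 E[Z_w^2],
   and the right-hand side of the theorem is A / Cost(T_S(v))^2 because
   CV^2 + 1 = E[Z^2] / E[Z]^2.  With a = c(v) and s = Cost(T_S(v)), unbiasedness
   turns the left-hand side into (A + a^2 + 2as) / (a + s)^2, which is at most
   A / s^2 as soon as s^2 <= A; the latter is Var(Z_v) >= 0. *)
Set Implicit Arguments.
Unset Strict Implicit.
Unset Printing Implicit Defensive.
Import Order.TTheory GRing.Theory Num.Theory.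
Local Open Scope ring_scope.

(** * Expectation over finitely supported distributions *)

Section Expect.
Variable R : realType.

(** A finite sum, so that the recursion is treated without measure theory; [SEI_law_integral] later
    identifies it with the integral against [SEI_law]. *)
Definition expect (A : Type) (d : dist R A) (f : A -> R) : R :=
  \sum_(o <- d) o.1 * f o.2.

Lemma eq_expect (A : Type) (d : dist R A) (f g : A -> R) :
  f =1 g -> expect d f = expect d g.
Proof. by move=> fg; apply: eq_bigr => o _; rewrite fg. Qed.

Lemma expect_ret (A : Type) (a : A) f : expect (dret R a) f = f a.
Proof. by rewrite /expect big_seq1 mul1r. Qed.

Lemma expect_bind (A A' : Type) (d : dist R A) (k : A -> dist R A') f :
  expect (dbind d k) f = expect d (fun a => expect (k a) f).
Proof.
rewrite /expect /dbind big_allpairs_dep; apply: eq_bigr => o _.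
by rewrite mulr_sumr; apply: eq_bigr => o' _; rewrite mulrA.
Qed.

Lemma expect_choose (I : finType) (A : {set I}) (w : I -> R) f :
  expect (dchoose A w) f = \sum_(i in A) w i / (\sum_(j in A) w j) * f i.
Proof. by rewrite /expect /dchoose big_map big_enum. Qed.

Lemma expect_affine (A : Type) (d : dist R A) (f : A -> R) (a b : R) :
  is_dist d -> expect d (fun x => a + b * f x) = a + b * expect d f.
Proof.
move=> [_ d1]; rewrite /expect -[X in X + _]mulr1 -d1 !mulr_sumr -big_split.
by apply: eq_bigr => o _ /=; ring.
Qed.

Lemma expect_sqrB (A : Type) (d : dist R A) (f : A -> R) (a : R) :
  is_dist d ->
  expect d (fun x => (f x - a) ^+ 2)
  = expect d (fun x => f x ^+ 2) - 2 * a * expect d f + a ^+ 2.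
Proof.
move=> [_ d1]; rewrite /expect -[X in _ + X]mulr1 -[X in _ + _ * X]d1 -mulNr !mulr_sumr.
by rewrite -!big_split; apply: eq_bigr => o _ /=; ring.
Qed.

Lemma expect_ge0 (A : Type) (d : dist R A) (f : A -> R) :
  is_dist d -> (forall x, 0 <= f x) -> 0 <= expect d f.
Proof.
move=> [+ _] f0; rewrite /expect; elim: d => [|o d IH] /=; first by rewrite big_nil.
by case/andP=> o0 /IH d0; rewrite big_cons addr_ge0// mulr_ge0.
Qed.

End Expect.

Lemma sum_bigcup_disjoint (R : nmodType) (I J : finType) (A : {set I})
    (F : I -> {set J}) (f : J -> R) :
  (forall i j z, i \in A -> j \in A -> z \in F i -> z \in F j -> i = j) ->
  \sum_(z in \bigcup_(i in A) F i) f z = \sum_(i in A) \sum_(z in F i) f z.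
Proof.
move=> Fdisj; rewrite (exchange_big_dep [pred z | z \in \bigcup_(i in A) F i]) /=.
  apply: eq_bigr => z /bigcupP[i iA zi]; rewrite (big_pred1 i) // => j.
  apply/idP/eqP => [/andP[jA zj]|->]; last by rewrite iA.
  exact: Fdisj zj zi.
by move=> i z iA zi; apply/bigcupP; exists i.
Qed.

(** * Decomposition of subtree costs by levels *)

Section TreeCost.
Variables (R : realType) (V : finType) (T : rootedTree V) (c : V -> {nonneg R}).

Lemma path_edge_iter (u : V) p : path (edge T) u p ->
  iter (size p) (obind (parent T)) (Some (last u p)) = Some u /\
  depth T (last u p) = (depth T u + size p)%N.
Proof.
elim/last_ind: p => [|p z IH]; first by rewrite addn0.
rewrite rcons_path last_rcons size_rcons => /andP[/IH[i1 i2] uz].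
by rewrite iterSr /= (eqP uz) (edge_depth uz) i2 addnS.
Qed.

(** Both u and w are reached by climbing from z, and equal depths mean equally many steps. Hence
    subtrees rooted at distinct nodes of the same depth are disjoint. *)
Lemma connect_edge_depth_inj (u w z : V) :
  connect (edge T) u z -> connect (edge T) w z -> depth T u = depth T w -> u = w.
Proof.
move=> /connectP[p /path_edge_iter[p1 p2] pz].
move=> /connectP[q /path_edge_iter[q1 q2] qz] uw.
have pq : size p = size q by apply/(@addnI (depth T u)); rewrite -p2 uw -q2 -pz -qz.
by move: p1; rewrite -pz pq qz q1 => -[].
Qed.

Lemma subtree_children (u : V) :
  subtree T u = u |: \bigcup_(w in children T u) subtree T w.
Proof.
apply/setP => z; rewrite !inE; apply/idP/orP.
  case/connectP=> -[|w p] /=; first by move=> _ ->; left.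
  case/andP=> uw pP ->; right; apply/bigcupP; exists w; rewrite inE//.
  by apply/connectP; exists p.
case=> [/eqP->|/bigcupP[w]]; first exact: connect0.
by rewrite !inE => /connect1 uw; exact: connect_trans.
Qed.

(** The union in [subtree_children] is disjoint: u lies strictly above its children, and these share
    one depth, so [connect_edge_depth_inj] separates their subtrees. *)
Lemma cost_subtree (u : V) :
  cost c (subtree T u) = (c u)%:num + Cost T c (children T u).
Proof.
rewrite subtree_children /cost big_setU1 /=; last first.
  apply/bigcupP => -[w]; rewrite !inE => uw.
  move=> /connectP[p /path_edge_iter[_ wd] up]; move/eqP: wd; rewrite -up (edge_depth uw).
  by rewrite ltn_eqF// addSn ltnS leq_addr.
congr (_ + _); apply: sum_bigcup_disjoint => w w' z.
rewrite !inE => uw uw' wz w'z; apply: connect_edge_depth_inj wz w'z _.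
by rewrite (edge_depth uw) (edge_depth uw').
Qed.

Lemma CostE (A : {set V}) : Cost T c A = cost c A + Cost T c (hchildren T A).
Proof.
rewrite {2}/Cost /hchildren sum_bigcup_disjoint; last first.
  (* A node has only one parent, so distinct nodes have disjoint sets of children. *)
  by move=> u w z _ _; rewrite !inE /edge => /eqP-> /eqP[->].
by rewrite /cost -big_split; apply: eq_bigr => u _; exact: cost_subtree.
Qed.

Lemma cost_ge0 (A : {set V}) : 0 <= cost c A.
Proof. exact: sumr_ge0. Qed.

Lemma le_Cost (A A' : {set V}) : A \subset A' -> Cost T c A <= Cost T c A'.
Proof.
move=> AA'; rewrite /Cost [leRHS](big_setID A) /= (setIidPr AA') lerDl.
by apply: sumr_ge0 => u _; exact: cost_ge0.
Qed.

End TreeCost.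

(** * The law of the next hypernode chosen by SEI *)

Section Estimator.
Variables (R : realType) (V : finType) (T : rootedTree V).
Variables (c : V -> {nonneg R}) (r : V -> {posnum R}) (B : nat).
Hypothesis B_gt0 : (0 < B)%N.
Implicit Types (v w x : {set V}).

Local Notation S := (hchildren T).

Lemma importance_gt0 (A : {set V}) : A != set0 -> 0 < importance r A.
Proof.
move=> /set0Pn[i iA].
by rewrite /importance (bigD1 i)//= ltr_wpDr// sumr_ge0.
Qed.

Definition draws (A : {set V}) (y : V) : {set {set V}} :=
  [set Z : {set V} | (Z \subset A :\ y) && (#|Z| == (minn B #|A|).-1)].

Lemma card_draws_setD1 (A : {set V}) (y : V) : y \in A ->
  #|draws A y| = 'C(#|A|.-1, (minn B #|A|).-1).
Proof. by move=> yA; rewrite cards_draws (cardsD1 y A) yA. Qed.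

Lemma hyperchildren_card v w :
  w \in hyperchildren T B v -> #|w| = minn B #|S v|.
Proof. by rewrite inE => /andP[_ /eqP]. Qed.

Lemma hyperchildren_neq0 v w :
  S v != set0 -> w \in hyperchildren T B v -> w != set0.
Proof.
by move=> S0 /hyperchildren_card wE; rewrite -card_gt0 wE leq_min B_gt0 card_gt0.
Qed.

(* Double counting of the pairs (y, w) with y in w; such a w is y |: Z for a
   unique Z. *)
Lemma sum_hyperchildren_weight v (f : V -> R) (g : {set V} -> R) :
  S v != set0 ->
  \sum_(w in hyperchildren T B v) (\sum_(y in w) f y) * g w
  = \sum_(y in S v) f y * \sum_(Z in draws (S v) y) g (y |: Z).
Proof.
move=> S0; have m_gt0 : (0 < minn B #|S v|)%N by rewrite leq_min B_gt0 card_gt0.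
transitivity (\sum_(y in S v) \sum_(w in hyperchildren T B v | y \in w) f y * g w).
  under eq_bigr do rewrite mulr_suml.
  apply: exchange_big_dep => w y; rewrite inE => /andP[/subsetP wS _]; exact: wS.
apply: eq_bigr => y yS; rewrite -mulr_sumr; congr (_ * _).
rewrite (reindex_onto (fun Z => y |: Z) (fun w => w :\ y)) /=; last first.
  by move=> w /andP[_ yw]; rewrite setD1K.
apply: eq_bigl => Z; rewrite !inE eqxx andbT.
(* If y is in Z, both sides are false: removing y from y |: Z does not give back Z, and [draws]
   excludes sets containing y. *)
have [yZ|yZ] := boolP (y \in Z).
  rewrite [RHS](_ : _ = false); last first.
    by apply/negP => /andP[/subsetP/(_ _ yZ)]; rewrite !inE eqxx.
  by apply/negP => /andP[_ /eqP/setP/(_ y)]; rewrite !inE eqxx yZ.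
rewrite setU1K// eqxx andbT subUset sub1set yS subsetD1 yZ andbT /=.
by rewrite cardsU1 yZ add1n -[in LHS](prednK m_gt0) eqSS.
Qed.

(** The number of completions Z of a given first choice y, which is also the number of hyperchildren
    containing y. *)
Local Notation N v := (('C(#|S v|.-1, (minn B #|S v|).-1))%:R : R).

Lemma natr_draws_neq0 v : N v != 0.
Proof.
by rewrite pnatr_eq0 -lt0n bin_gt0 -!subn1 leq_sub2r// geq_minr.
Qed.

(** A hyperchild w arises once for each y in w as first choice, each time with completion
    probability 1 / N v; the weights r(y) add up to r(w). *)
Lemma expect_step v (g : {set V} -> R) : S v != set0 ->
  expect (SEI_step T r B v) g
  = \sum_(w in hyperchildren T B v)
      importance r w / importance r (S v) / N v * g w.
Proof.
move=> S0; rewrite expect_bind expect_choose.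
transitivity (\sum_(y in S v) (r y)%:num / importance r (S v)
                * \sum_(Z in draws (S v) y) (N v)^-1 * g (y |: Z)).
  apply: eq_bigr => y yS; congr (_ * _); rewrite expect_bind expect_choose.
  apply: eq_bigr => Z _; rewrite expect_ret sumr_const card_draws_setD1//.
  by rewrite div1r.
rewrite -(sum_hyperchildren_weight (fun y => (r y)%:num / importance r (S v))
  (fun w => (N v)^-1 * g w) S0); apply: eq_bigr => w _.
by rewrite -mulr_suml -/(importance r w) mulrA.
Qed.

(** * Recursion for the estimator and its mean *)

Lemma SEI_loop_affine n x (D C a b : R) f :
  expect (SEI_loop T c r B n x (a * D) (b + a * C)) f
  = expect (SEI_loop T c r B n x D C) (fun t => f (b + a * t)).
Proof.
elim: n x D C => [|n IH] x D C /=; first by rewrite !expect_ret.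
case: ifP => _; first by rewrite !expect_ret.
rewrite [LHS]expect_bind [RHS]expect_bind; apply: eq_expect => w /=.
(* The increment of C is proportional to the current D, so after one step the two states are still
   related by the same a and b. *)
by rewrite -IH; congr (expect (SEI_loop _ _ _ _ _ _ _ _) f); ring.
Qed.

Definition expect_SEI v (f : R -> R) : R :=
  expect (SEI_output T c r B v) (fun t => f (#|v|%:R * t)).

Lemma SEI_output_dist v : is_dist (SEI_output T c r B v).
Proof. exact: SEI_run_dist. Qed.

Lemma expect_SEI_leaf v f : S v = set0 -> expect_SEI v f = f (cost c v).
Proof.
move=> S0; rewrite /expect_SEI /SEI_output SEI_runE S0 eqxx expect_ret.
(* For empty v the factor |v| = 0 already makes the estimator 0 = c(v), whatever the quotient by |v|
   is. *)
have [->|v0] := eqVneq v set0; first by rewrite cards0 mul0r /cost big_set0.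
by rewrite mulrCA divff ?mulr1// pnatr_eq0 cards_eq0.
Qed.

(* One step of the recursion |v| C(T_v) = c(v) + (r(S(v)) / r(w)) |w| C(T_w). *)
Lemma expect_SEI_rec v f : S v != set0 ->
  expect_SEI v f
  = \sum_(w in hyperchildren T B v)
      importance r w / importance r (S v) / N v
      * expect_SEI w (fun z =>
          f (cost c v + importance r (S v) / importance r w * z)).
Proof.
move=> S0; rewrite /expect_SEI {1}/SEI_output SEI_runE (negbTE S0) expect_bind.
rewrite expect_step//; apply: eq_bigr => w _; congr (_ * _).
rewrite mul1r /=; set D := _ * (_ / _).
(* The state after one step is the image of the fresh state (1, c(w)/|w|) under scaling by D and
   shifting by c(v)/|v|. *)
rewrite -{1}[D]mulr1 [_ * D]mulrC /SEI_run SEI_loop_affine.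
apply: eq_expect => t; congr (f _); rewrite /D.
have v0 : #|v|%:R != 0 :> R.
  rewrite pnatr_eq0 cards_eq0; apply: contraNneq S0 => v0.
  by rewrite /hchildren v0 big_set0.
rewrite mulrDr mulrCA divff// mulr1; congr (_ + _).
by move: (importance r (S v) / _) => rho; field.
Qed.

Lemma sum_hyperchildren_prob v : S v != set0 ->
  \sum_(w in hyperchildren T B v) importance r w / importance r (S v) / N v = 1.
Proof.
move=> S0; transitivity (expect (SEI_step T r B v) (fun=> 1)).
  by rewrite expect_step//; apply: eq_bigr => w _; rewrite mulr1.
by rewrite -[RHS](SEI_step_dist r B S0).2; apply: eq_bigr => o _; rewrite mulr1.
Qed.

(** Double counting: each node of S(v) lies in exactly N v hyperchildren, so its subtree is counted
    N v times. *)
Lemma sum_hyperchildren_Cost v : S v != set0 ->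
  \sum_(w in hyperchildren T B v) (N v)^-1 * Cost T c w = Cost T c (S v).
Proof.
move=> S0; under eq_bigr do rewrite mulrC.
rewrite (sum_hyperchildren_weight (fun u => cost c (subtree T u)) _ S0).
apply: eq_bigr => y yS.
rewrite sumr_const card_draws_setD1// -(mulr_natr (N v)^-1) mulVf ?natr_draws_neq0//.
by rewrite mulr1.
Qed.

(** The factor r(S(v)) / r(w) undoes the bias of the choice of w: what is left depends on no
    importance. This drives the unbiasedness and simplifies the second moment. *)
Lemma prob_importanceK v w : S v != set0 -> w != set0 ->
  importance r w / importance r (S v) / N v
    * (importance r (S v) / importance r w) = (N v)^-1.
Proof.
move=> /importance_gt0 S0 /importance_gt0 w0; field.
by rewrite natr_draws_neq0 !gt_eqF.
Qed.

(** Induction on a bound n for the sizes of the subtrees rooted in x, which strictly decrease from a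
    node to its child. *)
Lemma SEI_unbiased v : expect_SEI v id = Cost T c v.
Proof.
suff unb n x : (forall u, u \in x -> (#|subtree T u| <= n)%N) ->
    expect_SEI x id = Cost T c x.
  by apply: (unb #|V|) => u _; exact: max_card.
elim: n x => [|n IH] x xn; have [S0|S0] := eqVneq (S x) set0.
- by rewrite expect_SEI_leaf// CostE S0 [Cost _ _ set0]big_set0 addr0.
(* For n = 0 the set x has no element, since every subtree contains its root; so x has no
   children. *)
- case/set0Pn: S0 => z /bigcupP[u /xn]; rewrite leqn0 cards_eq0.
  by move=> /eqP/setP/(_ u); rewrite !inE connect0.
- by rewrite expect_SEI_leaf// CostE S0 [Cost _ _ set0]big_set0 addr0.
rewrite expect_SEI_rec// CostE -sum_hyperchildren_Cost//.
(* The constant c(x) is spread over the hyperchildren according to their probabilities, to compare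
   the sums term by term. *)
rewrite -[cost c x in RHS]mulr1 -[X in _ * X + _](sum_hyperchildren_prob S0).
rewrite mulr_sumr -big_split; apply: eq_bigr => w wH.
rewrite /expect_SEI expect_affine; last exact: SEI_output_dist.
rewrite -/(expect_SEI w id) IH; last first.
  move=> u uw; have : u \in S x by move: wH; rewrite inE => /andP[/subsetP wS _]; exact: wS.
  case/bigcupP => y /xn yn; rewrite inE => /subtree_child /leq_trans/(_ yn).
  by rewrite ltnS.
have w0 := hyperchildren_neq0 S0 wH.
by rewrite mulrDr mulrA (prob_importanceK S0 w0) [_ * cost c x]mulrC.
Qed.

Lemma expect_SEI_sqrB v a :
  expect_SEI v (fun z => (z - a) ^+ 2)
  = expect_SEI v (fun z => z ^+ 2) - 2 * a * Cost T c v + a ^+ 2.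
Proof. by rewrite -SEI_unbiased; apply/expect_sqrB/SEI_output_dist. Qed.

(** * From integrals against the law to finite sums *)

Lemma SEI_law_integral_ge0 v (f : R -> R) :
  measurable_fun [set: measurableTypeR R]%classic f -> (forall t, 0 <= f t) ->
  (\int[SEI_law T c r B v]_t (f t)%:E)%E = (expect (SEI_output T c r B v) f)%:E.
Proof.
move=> mf f0.
have mfE : measurable_fun [set: measurableTypeR R]%classic (EFin \o f).
  exact/measurable_EFinP.
have [ge0 _] := SEI_output_dist v; set d := SEI_output T c r B v.
(* Past the end of the list the default (0, 0) has weight 0, so [m] below is a measure for every
   i. *)
have w0 i : 0 <= (nth (0, 0) d i).1.
  by have [ilt|ige] := ltnP i (size d); [exact: (all_nthP _ ge0)|rewrite nth_default].
pose m i : {measure set (measurableTypeR R) -> \bar R} :=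
  mscale (NngNum (w0 i)) (\d_((nth (0, 0) d i).2 : measurableTypeR R)).
rewrite (@eq_measure_integral _ _ _ _ (msum m (size d))); last first.
  move=> A _ _; rewrite /= /SEI_law /msum -/d (big_nth (0, 0)) big_mkord.
  by apply: eq_bigr.
rewrite ge0_integral_measure_sum//; last by move=> t _; rewrite lee_fin.
rewrite /expect -/d (big_nth (0, 0)) big_mkord.
rewrite -sumEFin; apply: eq_bigr => i _.
rewrite ge0_integral_mscale//; last by move=> t _; rewrite lee_fin.
by rewrite integral_dirac// diracT mul1e.
Qed.

(** The positive and negative parts of f fall under the nonnegative case; both integrals are finite,
    so their difference is taken in R. *)
Lemma SEI_law_integral v (f : R -> R) :
  measurable_fun [set: measurableTypeR R]%classic f ->
  (\int[SEI_law T c r B v]_t (f t)%:E)%E = (expect (SEI_output T c r B v) f)%:E.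
Proof.
move=> mf; rewrite integralE.
have -> : ((fun t => (f t)%:E)^\+ = fun t => (Num.max (f t) 0)%:E)%E.
  by apply/boolp.funext => t; rewrite unlock EFin_max.
have -> : ((fun t => (f t)%:E)^\- = fun t => (Num.max (- f t) 0)%:E)%E.
  by apply/boolp.funext => t; rewrite unlock EFin_max EFinN.
rewrite !SEI_law_integral_ge0; last 4 first.
- exact: measurable_funrneg.
- by move=> t; rewrite le_max lexx orbT.
- exact: measurable_funrpos.
- by move=> t; rewrite le_max lexx orbT.
rewrite -EFinB /expect -sumrB; congr EFin; apply: eq_bigr => o _.
rewrite -mulrBr; congr (_ * _); have [f0|/ltW f0] := leP 0 (f o.2).
  by rewrite max_r ?oppr_le0// subr0.
by rewrite max_l ?oppr_ge0// sub0r opprK.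
Qed.

Lemma CV2_SEI_E v :
  CV2_SEI T c r B v
  = (expect_SEI v (fun z => z ^+ 2) - Cost T c v ^+ 2) / Cost T c v ^+ 2.
Proof.
have EE : ('E_(SEI_law T c r B v)[(fun C => #|v|%:R * C)%R] = (Cost T c v)%:E)%E.
  rewrite unlock SEI_law_integral; last exact: measurable_funM.
  by rewrite -SEI_unbiased.
pose Y t := #|v|%:R * t - Cost T c v.
have mY : measurable_fun [set: measurableTypeR R]%classic Y.
  by apply: measurable_funB => //; exact: measurable_funM.
have VE : ('V_(SEI_law T c r B v)[(fun C => #|v|%:R * C)%R]
    = (expect_SEI v (fun z => (z - Cost T c v) ^+ 2))%:E)%E.
  (* The variance is the covariance of the variable with itself, hence the expectation of the
     product of Y with itself. *)
  rewrite /variance unlock EE /= unlock.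
  exact: (SEI_law_integral v (measurable_funM mY mY)).
rewrite /CV2_SEI /CV2 EE VE /= expect_SEI_sqrB; congr (_ / _); ring.
Qed.

Lemma CV2_SEI_add1 v : Cost T c v != 0 ->
  CV2_SEI T c r B v + 1 = expect_SEI v (fun z => z ^+ 2) / Cost T c v ^+ 2.
Proof. by move=> v0; rewrite CV2_SEI_E; field. Qed.

Lemma sqr_Cost_le v : Cost T c v ^+ 2 <= expect_SEI v (fun z => z ^+ 2).
Proof.
have : 0 <= expect_SEI v (fun z => (z - Cost T c v) ^+ 2).
  by apply: expect_ge0 => [|x]; [exact: SEI_output_dist|exact: sqr_ge0].
by rewrite expect_SEI_sqrB; lra.
Qed.

End Estimator.

(** * Comparison of second moments across one step *)

Theorem theorem5 (R : realType) (V : finType) (T : rootedTree V)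
  (c : V -> {nonneg R}) (r : V -> {posnum R}) (B : nat) (hB : (1 <= B)%N)
  (v : {set V}) (hv : hypernode T v) (hS : hchildren T v != set0)
  (hCost : forall w : {set V}, w \in hyperchildren T B v -> 0 < Cost T c w) :
  CV2_SEI T c r B v + 1 <=
  \sum_(w in hyperchildren T B v)
     1 / ('C(#|hchildren T v|.-1, #|w|.-1))%:R
     * (importance r (hchildren T v) / importance r w)
     * (Cost T c w / Cost T c (hchildren T v)) ^+ 2
     * (CV2_SEI T c r B w + 1).
Proof.
set S := hchildren T v.
have S_gt0 : 0 < Cost T c S.
  (* A hyperchild exists because min(B, |S|) <= |S|; its positive cost bounds that of S from
     below. *)
  have [w wH] : exists w, w \in hyperchildren T B v.
    apply/set0Pn; rewrite -card_gt0 cards_draws bin_gt0; exact: geq_minr.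
  apply: lt_le_trans (hCost w wH) _; apply: le_Cost.
  by move: wH; rewrite inE => /andP[].
have vE : Cost T c v = cost c v + Cost T c S := CostE T c v.
have v_gt0 : 0 < Cost T c v by rewrite vE ltr_wpDl// cost_ge0.
pose A := expect_SEI T c r B v (fun z => (z - cost c v) ^+ 2).
have -> : \sum_(w in hyperchildren T B v)
     1 / ('C(#|S|.-1, #|w|.-1))%:R * (importance r S / importance r w)
     * (Cost T c w / Cost T c S) ^+ 2 * (CV2_SEI T c r B w + 1)
   = A / Cost T c S ^+ 2.
  rewrite /A expect_SEI_rec// mulr_suml; apply: eq_bigr => w wH.
  have w0 := hyperchildren_neq0 hB hS wH.
  rewrite CV2_SEI_add1 ?gt_eqF ?hCost// (hyperchildren_card wH).
  have -> : expect_SEI T c r B w (fun z =>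
       (cost c v + importance r S / importance r w * z - cost c v) ^+ 2)
     = (importance r S / importance r w) ^+ 2
         * expect_SEI T c r B w (fun z => z ^+ 2).
    rewrite /expect_SEI -[RHS]add0r -expect_affine; last exact: SEI_output_dist.
    by apply: eq_expect => t; ring.
  (* One of the two factors r(S) / r(w) cancels against the probability of w; the other is the one
     in the claimed sum. *)
  have sqrA (p q e : R) : p * (q ^+ 2 * e) = p * q * (q * e) by ring.
  rewrite sqrA prob_importanceK//; field.
  by rewrite natr_draws_neq0 !gt_eqF ?(hCost w)// importance_gt0.
have AE : A = expect_SEI T c r B v (fun z => z ^+ 2)
              - 2 * cost c v * Cost T c v + cost c v ^+ 2.
  exact: expect_SEI_sqrB.
have A_ge : Cost T c S ^+ 2 <= A.
  by have := sqr_Cost_le T c r hB v; rewrite AE vE; nra.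
rewrite CV2_SEI_add1 ?gt_eqF// ler_pdivrMr ?exprn_gt0//.
rewrite mulrAC ler_pdivlMr ?exprn_gt0//.
have -> : expect_SEI T c r B v (fun z => z ^+ 2)
   = A + (cost c v ^+ 2 + 2 * cost c v * Cost T c S) by rewrite AE vE; ring.
rewrite vE; have := cost_ge0 c v; move: (cost c v) (Cost T c S) S_gt0 A_ge => a s.
move=> s0 sA a0.
(* With k = a^2 + 2as the goal reads (A + k) s^2 <= A (s^2 + k), that is, k s^2 <= k A. *)
have k0 : 0 <= a ^+ 2 + 2 * a * s by nra.
have := ler_wpM2r k0 sA; nra.
Qed.
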